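(* Let $\mathcal{C}$ be a (nondegenerate) MSRD code with parameters $[\mathbf{n},k]_{q^m/q}$, with $\mathbf{n}=(n_1,\ldots,n_t)$ and $N=n_1+\cdots+n_t$. Then $\mathcal{C}$ is minimal if and only if it is a one-weight code with minimum distance $N-k+1$.
   Context: Let $q$ be a prime power, $m,t,k$ positive integers, $\mathbf{n}=(n_1,\ldots,n_t)$ a tuple of positive integers with $n_1\ge\cdots\ge n_t$, $N=n_1+\cdots+n_t$, and $\mathbb{F}_{q^m}^{\mathbf{n}}=\bigoplus_{i=1}^t\mathbb{F}_{q^m}^{n_i}$. The rank of $v=(v_1,\ldots,v_n)\in\mathbb{F}_{q^m}^n$ is $\mathrm{rk}(v)=\dim_{\mathbb{F}_q}\langle v_1,\ldots,v_n\rangle_{\mathbb{F}_q}$; the sum-rank weight of $x=(x_1,\ldots,x_t)\in\mathbb{F}_{q^m}^{\mathbf{n}}$ is $w(x)=\sum_{i=1}^t\mathrm{rk}(x_i)$, and the sum-rank distance is $d(x,y)=w(x-y)$. An $[\mathbf{n},k]_{q^m/q}$ (sum-rank metric) code is a $k$-dimensional $\mathbb{F}_{q^m}$-subspace $\mathcal{C}$ of $\mathbb{F}_{q^m}^{\mathbf{n}}$ with this distance; its minimum distance is the smallest weight of a nonzero codeword. A generator matrix is $G=(G_1|\cdots|G_t)$, $G_i\in\mathbb{F}_{q^m}^{k\times n_i}$, whose rows form a basis of $\mathcal{C}$. $\mathcal{C}$ is nondegenerate if for each $i$ the columns of $G_i$ are $\mathbb{F}_q$-linearly independent. All codes are assumed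 nondegenerate. $\mathcal{C}$ is MSRD (maximum sum-rank distance) if its minimum distance equals $N-k+1$. $\mathcal{C}$ is one-weight if all nonzero codewords have the same sum-rank weight. Support: fix an $\mathbb{F}_q$-basis of $\mathbb{F}_{q^m}$; for $x_i\in\mathbb{F}_{q^m}^{n_i}$ let $\Gamma(x_i)\in\mathbb{F}_q^{n_i\times m}$ be the matrix whose $j$-th row consists of the coordinates of the $j$-th entry of $x_i$. The sum-rank support of $x$ is the tuple $(\mathrm{colsp}\,\Gamma(x_1),\ldots,\mathrm{colsp}\,\Gamma(x_t))$ of $\mathbb{F}_q$-column spaces (independent of the basis); inclusion of supports is componentwise. A codeword $c\in\mathcal{C}$ is minimal if every $c'\in\mathcal{C}$ whose support is contained in the support of $c$ satisfies $c'=\lambda c$ for some $\lambda\in\mathbb{F}_{q^m}$. $\mathcal{C}$ is minimal if all its codewords are minimal. *)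

(* Defs.v *)
From HB Require Import structures.
From mathcomp Require Import all_boot all_order all_algebra all_field.

Set Implicit Arguments.
Unset Strict Implicit.
Unset Printing Implicit Defensive.

Import GRing.Theory.
Local Open Scope ring_scope.

(* F is the field with q elements and L its extension of degree m.  The space
   L^n1 (+) ... (+) L^nt is 'rV[L]_(\sum_i n i); the i-th block of x is
   submxrow x i : 'rV[L]_(n i). *)

Definition rk (F : finFieldType) (L : fieldExtType F) (r : nat)
    (v : 'rV[L]_r) : nat :=
  \dim (<<[seq v 0%R j | j : 'I_r]>>%VS : {vspace L}).

Definition sr_weight (F : finFieldType) (L : fieldExtType F) (t : nat)
    (n : 'I_t -> nat) (x : 'rV[L]_(\sum_i n i)) : nat :=
  (\sum_i rk (submxrow x i))%N.

(* "d is the smallest weight of a nonzero codeword" *)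
Definition is_min_distance (F : finFieldType) (L : fieldExtType F) (t : nat)
    (n : 'I_t -> nat) (C : {vspace 'rV[L]_(\sum_i n i)}) (d : nat) : Prop :=
  (exists c, [/\ c \in C, c != 0 & sr_weight c = d]) /\
  (forall c, c \in C -> c != 0 -> (d <= sr_weight c)%N).

Definition is_generator_matrix (L : fieldType) (k N : nat)
    (C : {vspace 'rV[L]_N}) (G : 'M[L]_(k, N)) : Prop :=
  basis_of C [seq row i G | i : 'I_k].

(* Independence over F, not over L: 'cV[L]_k carries no canonical structure of
   F-vector space, hence the embedding a%:A of a : F into L. *)
Definition columns_independent (F : finFieldType) (L : fieldExtType F)
    (k r : nat) (M : 'M[L]_(k, r)) : Prop :=
  forall a : 'I_r -> F,
    \sum_(j < r) (a j)%:A *: col j M = 0 -> forall j, a j = 0.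

(* The condition does not depend on the generator matrix: two of them differ by
   left multiplication by an invertible matrix. *)
Definition nondegenerate_code (F : finFieldType) (L : fieldExtType F) (t : nat)
    (n : 'I_t -> nat) (C : {vspace 'rV[L]_(\sum_i n i)}) : Prop :=
  exists2 G : 'M[L]_(\dim C, \sum_i n i), is_generator_matrix C G
    & forall i : 'I_t, columns_independent (submxrow G i).

(* The subtraction is not truncated, since \dim C <= \sum_i n i. *)
Definition MSRD (F : finFieldType) (L : fieldExtType F) (t : nat)
    (n : 'I_t -> nat) (C : {vspace 'rV[L]_(\sum_i n i)}) : Prop :=
  is_min_distance C (\sum_i n i - \dim C + 1)%N.

Definition one_weight (F : finFieldType) (L : fieldExtType F) (t : nat)
    (n : 'I_t -> nat) (C : {vspace 'rV[L]_(\sum_i n i)}) : Prop :=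
  forall c c', c \in C -> c != 0 -> c' \in C -> c' != 0 ->
    sr_weight c = sr_weight c'.

(* Meaningful when b is an F-basis of L. *)
Definition Gamma (F : finFieldType) (L : fieldExtType F) (m r : nat)
    (b : m.-tuple L) (v : 'rV[L]_r) : 'M[F]_(r, m) :=
  \matrix_(j < r, l < m) coord b l (v 0 j).

Definition colsp (F : fieldType) (r m : nat) (M : 'M[F]_(r, m)) :
    {vspace 'cV[F]_r} :=
  <<[seq col l M | l : 'I_m]>>%VS.

Definition sr_supp (F : finFieldType) (L : fieldExtType F) (m : nat)
    (b : m.-tuple L) (t : nat) (n : 'I_t -> nat)
    (x : 'rV[L]_(\sum_i n i)) (i : 'I_t) : {vspace 'cV[F]_(n i)} :=
  colsp (Gamma b (submxrow x i)).

Definition minimal_codeword (F : finFieldType) (L : fieldExtType F) (m : nat)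
    (b : m.-tuple L) (t : nat) (n : 'I_t -> nat)
    (C : {vspace 'rV[L]_(\sum_i n i)}) (c : 'rV[L]_(\sum_i n i)) : Prop :=
  c \in C /\
  forall c', c' \in C ->
    (forall i : 'I_t, (sr_supp b c' i <= sr_supp b c i)%VS) ->
    exists lambda : L, c' = lambda *: c.

Definition minimal_code (F : finFieldType) (L : fieldExtType F) (m : nat)
    (b : m.-tuple L) (t : nat) (n : 'I_t -> nat)
    (C : {vspace 'rV[L]_(\sum_i n i)}) : Prop :=
  forall c, c \in C -> minimal_codeword b C c.

(* Main.v *)
Require Import Defs.
From HB Require Import structures.
From mathcomp Require Import all_boot all_order all_algebra all_field.

Set Implicit Arguments.
Unset Strict Implicit.
Unset Printing Implicit Defensive.

Import GRing.Theory VectorInternalTheory.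
Local Open Scope ring_scope.

(* If c, c' are nonzero with supp c' inside supp c, choose lambda so that
   c' - lambda c vanishes at some position where c does not: its support is
   strictly smaller than supp c, so in a one-weight code it is zero.
   Conversely, having support inside supp c amounts to N - w(c) linear
   conditions over L; if w(c) > N - k + 1 then at least a 2-dimensional subspace
   of C satisfies them, so c is not minimal. *)

(** Dimension is by definition the rank in the internal coordinates [v2r]; passing to the
    coordinates [g] is right multiplication by the matrix [P], row-free as [g] is injective, so the
    rank is unchanged. *)
Lemma dim_span_inj_linear (K : fieldType) (V : vectType K) (n d : nat)
    (g : {linear V -> 'rV[K]_d}) (X : n.-tuple V) :
  injective g -> \dim <<X>> = \rank (\matrix_(i < n) g (tnth X i)).
Proof.
move=> g_inj; pose P := lin1_mx (g \o r2v).
have mulP u : u *m P = g (r2v u) by rewrite mul_rV_lin1.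
have freeP : row_free P.
  apply/inj_row_free => u; rewrite mulP -(linear0 g) => /g_inj.
  by rewrite -(linear0 r2v) => /r2v_inj.
have -> : \matrix_i g (tnth X i) = b2mx X *m P.
  by apply/row_matrixP => i; rewrite rowK row_mul rowK mulP v2rK.
rewrite mxrankMfree // unlock /dimv genmxE.
suff -> : in_tuple X = tcast (esym (size_tuple X)) X by case: _ / (esym _).
by apply/val_inj; rewrite /= val_tcast.
Qed.

(** The column space is the image of [mulmx M]; the transposes are there because [submx] compares
    row spaces. *)
Lemma mem_colsp (K : fieldType) (r m : nat) (M : 'M[K]_(r, m)) (u : 'cV_r) :
  (u \in colsp M) = (u^T <= M^T)%MS.
Proof.
apply/idP/submxP => [|[x ux]].
  have: (colsp M <= limg (linfun (mulmx M)))%VS.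
    apply/span_subvP => _ /imageP[l _ ->].
    by rewrite colE -(lfunE (mulmx M)); exact: memv_img (memvf _).
  move=> /subvP/[apply] /memv_imgP[x _ ->].
  by exists x^T; rewrite lfunE -trmx_mul.
rewrite -[u]trmxK ux mulmx_sum_row linear_sum.
apply/memv_suml => l _; rewrite linearZ /= -tr_col trmxK.
by apply/memvZ/memv_span/imageP; exists l.
Qed.

Lemma colsp_sub (K : fieldType) (r m p : nat) (M : 'M[K]_(r, m))
    (N : 'M[K]_(r, p)) : (colsp M <= colsp N)%VS = (M^T <= N^T)%MS.
Proof.
apply/span_subvP/row_subP => [MN l | MN _ /imageP[l _ ->]].
  by rewrite -tr_col -mem_colsp MN //; apply/imageP; exists l.
by rewrite mem_colsp tr_col.
Qed.

Lemma dim_colsp (K : fieldType) (r m : nat) (M : 'M[K]_(r, m)) :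
  \dim (colsp M) = \rank M.
Proof.
have -> : colsp M = <<[tuple col l M | l < m]>>%VS by [].
rewrite (dim_span_inj_linear (g := trmx) _ (@trmx_inj _ _ _)) -[in RHS]mxrank_tr.
by congr (\rank _); apply/row_matrixP => l; rewrite rowK tnth_mktuple /= tr_col.
Qed.

(** The rows of [Gamma b v] are the [coord_row b] of the entries of [v]. *)
Definition coord_row (K : fieldType) (V : vectType K) (m : nat)
  (b : m.-tuple V) (x : V) : 'rV[K]_m := \row_l coord b l x.

Fact coord_row_linear (K : fieldType) (V : vectType K) (m : nat)
  (b : m.-tuple V) : linear (coord_row b).
Proof. by move=> a x y; apply/rowP => l; rewrite !mxE linearP. Qed.

HB.instance Definition _ (K : fieldType) (V : vectType K) (m : nat)
    (b : m.-tuple V) :=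
  GRing.isSemilinear.Build K V 'rV[K]_m _ (coord_row b)
    (GRing.semilinear_linear (coord_row_linear b)).

Lemma coord_row_inj (K : fieldType) (V : vectType K) (m : nat)
    (b : m.-tuple V) : basis_of {:V} b -> injective (coord_row b).
Proof.
move=> hb x y /rowP xy; rewrite (coord_basis hb (memvf x)).
rewrite (coord_basis hb (memvf y)); apply: eq_bigr => l _.
by have := xy l; rewrite !mxE => ->.
Qed.

Lemma submxrowZ (R : pzRingType) (t m : nat) (n : 'I_t -> nat) (a : R)
    (A : 'M[R]_(m, \sum_i n i)) i :
  submxrow (a *: A) i = a *: submxrow A i.
Proof. by apply/matrixP => j l; rewrite !mxE. Qed.

Section Support.

Variables (F : finFieldType) (L : fieldExtType F) (m : nat) (b : m.-tuple L).
Hypothesis hb : basis_of {:L} b.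

Local Notation "A ^L" := (map_mx (in_alg L) A) (at level 2, format "A ^L").

Lemma rk_Gamma (r : nat) (v : 'rV[L]_r) : rk v = \rank (Gamma b v).
Proof.
have -> : rk v = \dim <<[tuple v 0%R j | j < r]>>%VS by [].
rewrite (dim_span_inj_linear _ (coord_row_inj hb)).
by congr (\rank _); apply/matrixP => j l; rewrite !mxE tnth_mktuple.
Qed.

(** The left side is the coordinate row of the scalar [v *m a^L]. So left annihilators of
    [Gamma b v] are the F-linear relations among the entries of [v], a condition that is L-linear in
    [v]. *)
Lemma annihilate_Gamma (r : nat) (v : 'rV[L]_r) (a : 'cV[F]_r) :
  (a^T *m Gamma b v == 0) = (v *m a^L == 0).
Proof.
have -> : a^T *m Gamma b v = coord_row b ((v *m a^L) 0 0).
  apply/rowP => l; rewrite !mxE linear_sum /=; apply: eq_bigr => j _.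
  by rewrite !mxE mulr_algr linearZ.
rewrite -(linear0 (coord_row b)) (inj_eq (coord_row_inj hb)).
apply/eqP/eqP => [va0 | ->]; last by rewrite mxE.
by rewrite [v *m _]mx11_scalar va0 raddf0.
Qed.

(** Duality: taking annihilators reverses inclusion of column spaces and loses nothing in finite
    dimension. *)
Lemma colsp_Gamma_subP (r : nat) (v w : 'rV[L]_r) :
  (colsp (Gamma b v) <= colsp (Gamma b w))%VS <->
  (forall a : 'cV[F]_r, w *m a^L = 0 -> v *m a^L = 0).
Proof.
rewrite colsp_sub; split=> [/submxP[D vDw] a /eqP | wv].
  rewrite -annihilate_Gamma => /eqP aw; apply/eqP; rewrite -annihilate_Gamma.
  by rewrite -[Gamma b v]trmxK vDw trmx_mul trmxK mulmxA aw mul0mx.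
rewrite submxE; apply/eqP/trmx_inj; rewrite trmx0 trmx_mul trmxK.
(* The rows of [N] annihilate [Gamma b w], so testing the hypothesis on them suffices. *)
set N := (cokermx _)^T; apply/row_matrixP => j; rewrite row_mul row0.
apply/eqP; rewrite -[row j N]trmxK annihilate_Gamma; apply/eqP/wv/eqP.
rewrite -annihilate_Gamma trmxK -row_mul.
by rewrite -[Gamma b w]trmxK -trmx_mul mulmx_coker trmx0 row0.
Qed.

Variables (t : nat) (n : 'I_t -> nat).
Implicit Types (x y c : 'rV[L]_(\sum_i n i)) (C : {vspace 'rV[L]_(\sum_i n i)}).

Lemma sr_weight_supp x : sr_weight x = (\sum_i \dim (sr_supp b x i))%N.
Proof. by apply: eq_bigr => i _; rewrite rk_Gamma dim_colsp. Qed.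

(** The weight is the sum of the block dimensions; termwise inequalities with equal sums are all
    equalities. *)
Lemma sr_supp_le_eq x y : (forall i, sr_supp b x i <= sr_supp b y i)%VS ->
  sr_weight x = sr_weight y -> forall i, (sr_supp b y i <= sr_supp b x i)%VS.
Proof.
move=> xy; rewrite !sr_weight_supp => wxy i.
have /leqif_sum[_] : forall j, true -> (\dim (sr_supp b x j)
    <= \dim (sr_supp b y j) ?= iff (sr_supp b y j <= sr_supp b x j)%VS)%N.
  by move=> j _; apply: dimv_leqif_sup.
by rewrite wxy eqxx => /esym/forall_inP/(_ i); apply.
Qed.

Lemma one_weight_minimal C : one_weight C -> minimal_code b C.
Proof.
move=> C1 c cC; split=> // c' c'C sub.
have sub0 i := (colsp_Gamma_subP _ _).1 (sub i).
have [c0|c_neq0] := eqVneq c 0.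
  exists 0; rewrite scale0r; apply/mxrowP => i; rewrite submxrow0.
  (* The zero word satisfies every relation, in particular the unit vectors, which read off each
     entry of [c']. *)
  apply/rowP => j; have := sub0 i (delta_mx j 0).
  rewrite c0 submxrow0 mul0mx map_delta_mx -colE => /(_ erefl)/rowP/(_ 0).
  by rewrite !mxE.
have [i ci_neq0] : exists i, submxrow c i != 0.
  apply/existsP; apply: contraNT c_neq0 => /existsPn c0.
  apply/eqP/mxrowP => i; rewrite submxrow0; apply/eqP.
  by have := c0 i; rewrite negbK.
have /rV0Pn[j cij_neq0] := ci_neq0.
pose lambda := submxrow c' i 0 j / submxrow c i 0 j.
exists lambda; apply/eqP; rewrite -subr_eq0; apply: contraT => diff_neq0.
have diffC : c' - lambda *: c \in C by rewrite memvB // memvZ.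
have diff_sub h : (sr_supp b (c' - lambda *: c) h <= sr_supp b c h)%VS.
  apply/colsp_Gamma_subP => a ca0; rewrite submxrowB submxrowZ mulmxBl.
  by rewrite -scalemxAl ca0 (sub0 _ _ ca0) scaler0 subr0.
(* Equal weights would make the supports equal, so the unit relation at [j], satisfied by the
   difference, would force entry [j] of block [i] of [c] to vanish. *)
have /colsp_Gamma_subP/(_ (delta_mx j 0)) :=
  sr_supp_le_eq diff_sub (C1 _ _ diffC diff_neq0 cC c_neq0) i.
rewrite map_delta_mx -!colE submxrowB submxrowZ.
have col0 : col j (submxrow c' i - lambda *: submxrow c i) = 0.
  rewrite mxE in cij_neq0; apply/colP => l.
  by rewrite ord1 !mxE /lambda !mxE divfK ?subrr.
by move=> /(_ col0)/colP/(_ 0); rewrite [LHS]mxE [RHS]mxE => /eqP/(negP cij_neq0).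
Qed.

Lemma dim_sub_supp_ge C c :
  exists2 U : {vspace 'rV[L]_(\sum_i n i)},
    (\dim C + sr_weight c <= \dim (C :&: U) + \sum_i n i)%N
    & forall x, x \in U -> forall i, (sr_supp b x i <= sr_supp b c i)%VS.
Proof.
(* The columns of [A i] are an F-basis of the relations among the entries of block [i] of [c]; [U]
   is the L-space of words satisfying all of them. *)
pose A i := (row_base (kermx (Gamma b (submxrow c i))))^T.
pose f x := \mxrow_i (submxrow x i *m (A i)^L).
have f_lin : linear f.
  move=> a x y; apply/mxrowP => i; rewrite submxrowD submxrowZ !mxrowK.
  by rewrite submxrowD submxrowZ mulmxDl scalemxAl.
pose fL : {linear _ -> _} := HB.pack f (GRing.isLinear.Build L _ _ _ f f_lin).
exists (lker (linfun fL)) => [|x]; last first.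
  rewrite memv_ker lfunE /= => /eqP/mxrowP fx0 i.
  apply/colsp_Gamma_subP => a /eqP; rewrite -annihilate_Gamma => /eqP.
  move=> /sub_kermxP; rewrite -(eq_row_base (kermx _)) => /submxP[D /(congr1 trmx)].
  have := fx0 i; rewrite mxrowK submxrow0 trmx_mul trmxK => xA0 ->.
  by rewrite map_mxM mulmxA xA0 mul0mx.
rewrite -(limg_ker_dim (linfun fL) C) -addnA leq_add2l.
(* Rank-nullity on [C]: the image has at most as many dimensions as there are conditions, namely
   [n i - rk] for each block. *)
have /leq_trans -> // : (\dim (linfun fL @: C) + sr_weight c
    <= \sum_i \rank (kermx (Gamma b (submxrow c i))) + sr_weight c)%N.
  by rewrite leq_add2r (leq_trans (dimvS (subvf _))) // dimvf dim_matrix mul1r.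
rewrite /sr_weight -big_split /= leq_sum // => i _.
by rewrite mxrank_ker rk_Gamma subnK // rank_leq_row.
Qed.

Lemma minimal_sr_weight_le C c : minimal_codeword b C c -> c != 0 ->
  (sr_weight c + \dim C <= \sum_i n i + 1)%N.
Proof.
move=> [cC minc] c_neq0; have [U dimU subU] := dim_sub_supp_ge C c.
have CUc : (C :&: U <= <[c]>)%VS.
  apply/subvP => x; rewrite memv_cap => /andP[xC /subU/(minc _ xC)[a ->]].
  exact/memvZ/memv_line.
have := dimvS CUc; rewrite dim_vline c_neq0 => dimCU.
by rewrite addnC (leq_trans dimU) // [leqRHS]addnC leq_add2r.
Qed.

End Support.

Theorem corollary2p5 (F : finFieldType) (L : fieldExtType F) (m t k : nat)
    (hm : (0 < m)%N) (ht : (0 < t)%N) (hk : (0 < k)%N)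
    (b : m.-tuple L) (hb : basis_of {:L} b)
    (n : 'I_t -> nat) (hn : forall i, (0 < n i)%N)
    (hmono : forall i j : 'I_t, (i <= j)%N -> (n j <= n i)%N)
    (C : {vspace 'rV[L]_(\sum_i n i)}) (hdim : \dim C = k)
    (hnd : nondegenerate_code C) (hC : MSRD C) :
  minimal_code b C <->
  one_weight C /\ is_min_distance C (\sum_i n i - k + 1)%N.
Proof.
rewrite -hdim; split=> [minC | [C1 _]]; last exact: one_weight_minimal.
split=> //; case: hC => _ minw.
suff wE c : c \in C -> c != 0 -> sr_weight c = (\sum_i n i - \dim C + 1)%N.
  by move=> c c' cC c0 c'C c'0; rewrite !wE.
move=> cC c_neq0; apply/eqP; rewrite eqn_leq minw // andbT.
have := minimal_sr_weight_le hb (minC c cC) c_neq0.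
(* This makes the truncated subtraction in the minimum distance a genuine one. *)
have : (\dim C <= \sum_i n i)%N.
  by rewrite (leq_trans (dimvS (subvf C))) // dimvf dim_matrix mul1r.
move=> dimC; rewrite addnBAC // leq_subRL ?(leq_trans dimC) ?leq_addr //.
by rewrite addnC.
Qed.
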